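(* Let $X,Y\subset\mathbb{R}^n$ be closed convex sets with $S:=X\cap Y\neq\varnothing$. Let $T:\mathbb{R}^n\to\mathbb{R}^n$ be an admissible operator such that $T(\mathbb{R}^n)\subset P_Y(X)$, let $(\alpha_k)_{k\ge 0}\subset(0,1)$ be an arbitrary sequence, let $z_0\in\mathbb{R}^n$, and let $(z_k)_{k\ge 0}$ be the ecCRM iterates $z_{k+1}=\mathrm{PCRM}\bigl(N^{\alpha_k}z_k\bigr)$, $k\ge 0$, which converge to a point $\bar z\in S$. Assume that (i) $\mathrm{int}(S)\neq\varnothing$; (ii) $\bar z\in\partial X\cap\partial Y$ and, in a neighborhood of $\bar z$, the boundaries $\partial X$ and $\partial Y$ are $C^1$ manifolds of dimension $n-1$. Then $(\mathrm{dist}(z_k,S))_{k\ge 0}$ converges to $0$ superlinearly, and $(z_k)$ converges to $\bar z$ superlinearly.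
   Context: $\mathbb{R}^n$ carries the Euclidean inner product and norm; $\mathrm{dist}(z,C)=\inf_{y\in C}\|z-y\|$. For a nonempty closed convex set $C$, $P_C$ is the metric projection onto $C$ and $R_C:=2P_C-\mathrm{Id}$ is the reflection; $P_Y(X)=\{P_Yx : x\in X\}$. Circumcenter: for $z,v,w\in\mathbb{R}^n$, $\operatorname{circ}(z,v,w)$ is the point $c$ in the affine hull of $\{z,v,w\}$ with $\|c-z\|=\|c-v\|=\|c-w\|$; when it exists it is unique. Define $\mathrm{PCRM}(z):=\operatorname{circ}(z,R_X(z),R_Y(z))$. A point $z$ is centralized if $\langle z-P_Xz,\,z-P_Yz\rangle\le 0$. At centralized points the circumcenter defining $\mathrm{PCRM}(z)$ exists, and the points $N^{\alpha}z$ below are always centralized. Admissible operator: $T:\mathbb{R}^n\to\mathbb{R}^n$ is admissible if $T(\mathbb{R}^n)\subset Y$ and $\|Tz-s\|\le\|z-s\|$ for all $z\in\mathbb{R}^n$, $s\in S$. For $\alpha\in(0,1)$, $N^{\alpha}z:=\alpha\,Tz+(1-\alpha)\,P_X(Tz)$. The ecCRM iterates always converge to a point of $S$ (so $\bar z$ is well defined). A nonnegative sequence $(a_k)$ with $a_k\to 0$ converges superlinearly to $0$ if $a_{k+1}/a_k\to 0$, understood as: for every $\varepsilon>0$, $a_{k+1}\le\varepsilon a_k$ for all large $k$ (this includes the case where $a_k$ is eventually $0$). A sequence $(z_k)$ converges superlinearly to $\bar z$ if $\|z_k-\bar z\|$ converges superlinearly to $0$. *)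

(* Defs.v *)
From HB Require Import structures.
From mathcomp Require Import all_boot all_order all_algebra.
From mathcomp Require Import all_classical all_reals all_analysis.

Set Implicit Arguments.
Unset Strict Implicit.
Unset Printing Implicit Defensive.
Import Order.TTheory GRing.Theory Num.Theory.
Import numFieldNormedType.Exports.
Local Open Scope classical_set_scope.
Local Open Scope ring_scope.

(* The canonical norm `|u| of 'rV[R]_n is the maximum norm.  It induces the
   Euclidean topology and the usual notion of differentiability, so the library
   notions closed, interior, --> and differentiable are used as they are,
   whereas every metric notion below goes through enorm. *)
Definition dotv (R : realType) (n : nat) (u v : 'rV[R]_n) : R :=
  \sum_(i < n) u ord0 i * v ord0 i.

Definition enorm (R : realType) (n : nat) (u : 'rV[R]_n) : R :=
  Num.sqrt (dotv u u).

Definition dist_set (R : realType) (n : nat) (z : 'rV[R]_n) (C : set 'rV[R]_n) : R :=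
  inf [set enorm (z - y) | y in C].

(* [get P] is a point satisfying P when there is one, and a default vector
   otherwise; for C nonempty, closed and convex it is the unique nearest
   point. *)
Definition metric_proj (R : realType) (n : nat) (C : set 'rV[R]_n)
    (z : 'rV[R]_n) : 'rV[R]_n :=
  get [set p | C p /\ enorm (z - p) = dist_set z C].

Definition reflection (R : realType) (n : nat) (C : set 'rV[R]_n)
    (z : 'rV[R]_n) : 'rV[R]_n :=
  2%:R *: metric_proj C z - z.

Definition affine_hull3 (R : realType) (n : nat) (z v w : 'rV[R]_n) :
    set 'rV[R]_n :=
  [set x | exists a b c : R, a + b + c = 1 /\ x = a *: z + b *: v + c *: w].

Definition is_circumcenter (R : realType) (n : nat) (z v w c : 'rV[R]_n) : Prop :=
  [/\ affine_hull3 z v w c,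
      enorm (c - z) = enorm (c - v) & enorm (c - v) = enorm (c - w)].

Definition circ (R : realType) (n : nat) (z v w : 'rV[R]_n) : 'rV[R]_n :=
  get (is_circumcenter z v w).

Definition PCRM (R : realType) (n : nat) (X Y : set 'rV[R]_n)
    (z : 'rV[R]_n) : 'rV[R]_n :=
  circ z (reflection X z) (reflection Y z).

Definition admissible (R : realType) (n : nat) (X Y : set 'rV[R]_n)
    (T : 'rV[R]_n -> 'rV[R]_n) : Prop :=
  range T `<=` Y /\
  forall z s, (X `&` Y) s -> enorm (T z - s) <= enorm (z - s).

Definition centralizer (R : realType) (n : nat) (X : set 'rV[R]_n)
    (T : 'rV[R]_n -> 'rV[R]_n) (alpha : R) (z : 'rV[R]_n) : 'rV[R]_n :=
  alpha *: T z + (1 - alpha) *: metric_proj X (T z).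

Definition boundary (T : topologicalType) (A : set T) : set T :=
  closure A `\` A°.

Definition C1_on (R : realType) (m n : nat) (U : set 'rV[R]_m)
    (f : 'rV[R]_m -> 'rV[R]_n) : Prop :=
  forall x, U x -> differentiable f x /\ {for x, continuous (jacobian f)}.

Definition C1_diffeo (R : realType) (n : nat) (U V : set 'rV[R]_n)
    (h : 'rV[R]_n -> 'rV[R]_n) : Prop :=
  [/\ open U, open V, C1_on U h, h @` U = V &
      exists g, [/\ C1_on V g, g @` V = U & {in U, cancel h g}]].

(* Embedded k-dimensional C^1 submanifold: around each of its points, a
   C^1 diffeomorphism of open sets of R^n straightens M onto R^k x {0}. *)
Definition C1_submanifold (R : realType) (n k : nat) (M : set 'rV[R]_n) : Prop :=
  forall p, M p -> exists U V h, [/\ U p, C1_diffeo U V h &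
    h @` (M `&` U) = V `&` [set y | forall i : 'I_n, (k <= i)%N -> y ord0 i = 0]].

Definition C1_submanifold_near (R : realType) (n k : nat) (M : set 'rV[R]_n)
    (p : 'rV[R]_n) : Prop :=
  exists W, open_nbhs p W /\ C1_submanifold k (M `&` W).

Definition superlinear0 (R : realType) (a : nat -> R) : Prop :=
  [/\ forall k, 0 <= a k, a @ \oo --> 0 &
      forall eps : R, 0 < eps -> \forall k \near \oo, a k.+1 <= eps * a k].

Definition superlinear (R : realType) (n : nat) (z : nat -> 'rV[R]_n)
    (zbar : 'rV[R]_n) : Prop :=
  superlinear0 (fun k => enorm (z k - zbar)).

(* Main.v *)
Require Import Defs.
From HB Require Import structures.
From mathcomp Require Import all_boot all_order all_algebra.
From mathcomp Require Import all_classical all_reals all_analysis.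
From mathcomp Require Import ring lra.
Import Order.TTheory GRing.Theory Num.Theory.
Import numFieldNormedType.Exports.
Local Open Scope classical_set_scope.
Local Open Scope ring_scope.

(* Outside X, the point w = N^alpha z lies outside Y as well, thanks to
   T(R^n) being contained in P_Y(X), so z' = PCRM w is the projection of w onto
   the intersection of the hyperplanes supporting X at P_X w and Y at P_Y w.
   Hence |z' - w| <= dist(w, S) <= dist(z, S).  Smoothness makes the unit outer
   normals of X and of Y at zbar unique, and by compactness those at nearby
   points are close to them; so when w is near zbar, a displacement of length
   o(|z' - w|) towards a fixed interior point s0 of S brings z' into both X and
   Y.  Thus dist(z', S) = o(dist(z, S)), and Fejer monotonicity, which gives
   |z - zbar| <= 2 dist(z, S), transfers the rate to the iterates. *)

(** * Euclidean inner product and norm, and their link to the topology of the maximum norm *)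

Section euclidean.
Context {R : realType} {n : nat}.
Implicit Types (u v w : 'rV[R]_n) (a : R).

Lemma dotvC u v : dotv u v = dotv v u.
Proof. by apply: eq_bigr => i _; rewrite mulrC. Qed.

Lemma dotvDl u v w : dotv (u + v) w = dotv u w + dotv v w.
Proof. by rewrite -big_split; apply: eq_bigr => i _; rewrite mxE mulrDl. Qed.

Lemma dotvZl a u v : dotv (a *: u) v = a * dotv u v.
Proof. by rewrite mulr_sumr; apply: eq_bigr => i _; rewrite mxE mulrA. Qed.

Lemma dotvNl u v : dotv (- u) v = - dotv u v.
Proof. by rewrite -scaleN1r dotvZl mulN1r. Qed.

Lemma dotvDr u v w : dotv u (v + w) = dotv u v + dotv u w.
Proof. by rewrite dotvC dotvDl !(dotvC u). Qed.

Lemma dotvZr a u v : dotv u (a *: v) = a * dotv u v.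
Proof. by rewrite dotvC dotvZl (dotvC u). Qed.

Lemma dotvNr u v : dotv u (- v) = - dotv u v.
Proof. by rewrite dotvC dotvNl (dotvC u). Qed.

Definition dotvE := (dotvDl, dotvDr, dotvNl, dotvNr, dotvZl, dotvZr).

Lemma dotv0 u : dotv u 0 = 0.
Proof. by rewrite -(scale0r 0) dotvZr mul0r. Qed.

Lemma dotv_ge0 u : 0 <= dotv u u.
Proof. by apply: sumr_ge0 => i _; rewrite -expr2 sqr_ge0. Qed.

Lemma enorm_ge0 u : 0 <= enorm u.
Proof. exact: sqrtr_ge0. Qed.

Lemma enorm_sqr u : enorm u ^+ 2 = dotv u u.
Proof. by rewrite sqr_sqrtr// dotv_ge0. Qed.

Lemma coord_le_enorm u (i : 'I_n) : `|u ord0 i| <= enorm u.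
Proof.
rewrite -sqrtr_sqr ler_wsqrtr// /dotv (bigD1 i)//= expr2 lerDl.
by apply: sumr_ge0 => j _; rewrite -expr2 sqr_ge0.
Qed.

Lemma norm_le_enorm u : `|u| <= enorm u.
Proof.
rewrite /Num.norm/= mx_normrE; apply: bigmax_le => [|[i j] _]; first exact: enorm_ge0.
by rewrite /= (ord1 i) coord_le_enorm.
Qed.

Lemma enorm_eq0 u : (enorm u == 0) = (u == 0).
Proof.
apply/eqP/eqP => [u0|->]; last by rewrite /enorm dotv0 sqrtr0.
by apply/eqP; rewrite -normr_le0 -u0 norm_le_enorm.
Qed.

Lemma enorm_gt0 u : (0 < enorm u) = (u != 0).
Proof. by rewrite lt0r enorm_ge0 andbT enorm_eq0. Qed.

Lemma dotv_gt0 u : u != 0 -> 0 < dotv u u.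
Proof. by rewrite -enorm_sqr exprn_even_gt0//= enorm_eq0. Qed.

Lemma enormZ a u : enorm (a *: u) = `|a| * enorm u.
Proof. by rewrite /enorm !dotvE mulrA -expr2 sqrtrM ?sqr_ge0// sqrtr_sqr. Qed.

Lemma enormB u v : enorm (u - v) = enorm (v - u).
Proof. by rewrite -opprB -scaleN1r enormZ normrN1 mul1r. Qed.

Lemma enorm_le u v : (enorm u <= enorm v) = (dotv u u <= dotv v v).
Proof. by rewrite -!enorm_sqr ler_pXn2r// nnegrE enorm_ge0. Qed.

Lemma enorm_eq u v : (enorm u = enorm v) <-> (dotv u u = dotv v v).
Proof. by split=> uv; [rewrite -!enorm_sqr uv | rewrite /enorm uv]. Qed.

(** Cauchy-Schwarz: the squared norm of [dotv v v *: u - dotv u v *: v] is [dotv v v] times the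
    difference of the two sides. *)
Lemma dotv_sqr_le u v : dotv u v ^+ 2 <= dotv u u * dotv v v.
Proof.
have [->|v0] := eqVneq v 0; first by rewrite !dotv0 expr0n mulr0.
have vv := dotv_gt0 _ v0.
have := dotv_ge0 (dotv v v *: u - dotv u v *: v).
rewrite !dotvE (dotvC v u).
move=> h; rewrite -subr_ge0 -(pmulr_rge0 _ vv); lra.
Qed.

Lemma dotv_le_enorm u v : dotv u v <= enorm u * enorm v.
Proof.
apply: le_trans (ler_norm _) _.
rewrite -(@ler_pXn2r _ 2)// ?nnegrE ?mulr_ge0 ?enorm_ge0 ?normr_ge0//.
by rewrite exprMn !enorm_sqr real_normK ?num_real// dotv_sqr_le.
Qed.

Lemma enormD_le u v : enorm (u + v) <= enorm u + enorm v.
Proof.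
rewrite -(@ler_pXn2r _ 2)// ?nnegrE ?addr_ge0 ?enorm_ge0// sqrrD !enorm_sqr.
have := dotv_le_enorm u v; rewrite !dotvE (dotvC v u); lra.
Qed.

Lemma enorm_dist_triangle v u w : enorm (u - w) <= enorm (u - v) + enorm (v - w).
Proof. by apply: le_trans (enormD_le _ _); rewrite addrA subrK. Qed.

Lemma dotv_continuous (U : topologicalType) (f g : U -> 'rV[R]_n) x :
  {for x, continuous f} -> {for x, continuous g} ->
  {for x, continuous (fun y => dotv (f y) (g y))}.
Proof.
move=> fx gx; apply: cvg_big => [|i _]; first exact: add_continuous.
have coord (h : U -> 'rV[R]_n) : {for x, continuous h} ->
    h y ord0 i @[y --> x] --> h x ord0 i.
  by move=> hx; exact: (continuous_comp hx (@coord_continuous _ _ _ _ _ _)).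
exact: cvgM (coord _ fx) (coord _ gx).
Qed.

Lemma enorm_continuous : continuous (@enorm R n).
Proof.
move=> u; apply: continuous_comp; last exact: sqrt_continuous.
by apply: dotv_continuous; exact: cvg_id.
Qed.

Lemma enorm_nbhs (A : set 'rV[R]_n) u :
  nbhs u A -> exists2 d, 0 < d & forall v, enorm (v - u) < d -> A v.
Proof.
move=> /nbhs_normP[d /= d0 dA]; exists d => // v vu; apply: dA => /=.
by rewrite distrC (le_lt_trans (norm_le_enorm _)).
Qed.

End euclidean.

(** * Outer normals, and their uniqueness at smooth boundary points *)

Section normals.
Context {R : realType} {n : nat}.
Implicit Types (X : set 'rV[R]_n) (m q e : 'rV[R]_n).

(** For [q] in [X] this is the normal cone. Leaving [q] free also covers directions that separate an
    outside point from [X], as [smooth_push] needs. *)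
Definition outer_normal X q m := forall x, X x -> dotv m (x - q) <= 0.

(** The difference quotients of [g] along [e] with positive step pair nonpositively with [m]; the
    sign survives in the limit. *)
Lemma outer_normal_diff X m (g : 'rV[R]_n -> 'rV[R]_n) q e :
  differentiable g q -> outer_normal X (g q) m ->
  (\forall t \near (0 : R), X (g (q + t *: e))) -> dotv m ('d g q e) <= 0.
Proof.
move=> dg gm gX.
have dge : (fun h : R => h^-1 *: (g (h *: e + q) - g q)) @ 0^'+ --> 'd g q e.
  rewrite -deriveE//; apply: cvg_dnbhs_at_right.
  exact: diff_derivable.
have mc : {for 'd g q e, continuous (dotv m)}.
  by apply: (@dotv_continuous _ _ _ (cst m) id); [exact: cst_continuous | exact: cvg_id].
apply: (cvgr_to_le (cvg_comp _ _ dge mc)).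
near=> h.
have h0 : 0 < h by near: h; exact: nbhs_right_gt.
rewrite /= dotvZr pmulr_rle0 ?invr_gt0//; apply: gm.
by rewrite addrC; near: h; exact: cvg_at_right_filter gX.
Unshelve. all: by end_near. Qed.

Lemma diff_cancel (g h : 'rV[R]_n -> 'rV[R]_n) q v :
  differentiable h q -> differentiable g (h q) ->
  (\forall y \near q, g (h y) = y) -> 'd g (h q) ('d h q v) = v.
Proof.
move=> dh dg gh; have dgh := differentiable_comp dh dg.
rewrite -[LHS](congr1 (@^~ v) (diff_comp dh dg)) -deriveE//.
by rewrite (@near_eq_derive _ _ _ _ id)// derive_id.
Qed.

(** A ball around [s] lies in [X], and testing the normal at [s] shifted along [m] gives the bound.
    The depth [r] is uniform in [q] and [m]. *)
Lemma outer_normal_interior X s : X° s ->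
  exists2 r, 0 < r & forall q m, outer_normal X q m -> enorm m = 1 ->
    dotv m (s - q) <= - r.
Proof.
move=> /enorm_nbhs[d d0 dX]; exists (d / 2); first by rewrite divr_gt0.
move=> q m mq m1; have : X (s + (d / 2) *: m).
  apply: dX; rewrite addrAC subrr add0r enormZ m1 mulr1 gtr0_norm ?divr_gt0//.
  by rewrite ltr_pdivrMr// ltr_pMr// ltr1n.
by move/mq; rewrite !dotvE -enorm_sqr m1; lra.
Qed.

(** An outer normal pairs nonpositively with a tangent direction and with its opposite, hence
    vanishes on a hyperplane. All outer normals thus lie on one line, and an interior point fixes
    the orientation. *)
Lemma outer_normal_smooth X q : closed X ->
  X° !=set0 -> boundary X q -> C1_submanifold_near n.-1 (boundary X) q ->
  forall m m', outer_normal X q m -> outer_normal X q m' ->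
  enorm m = 1 -> enorm m' = 1 -> m = m'.
Proof.
move=> cX [s0 s0X] Xq [W [[oW Wq] /(_ q (conj Xq Wq))[U [V [h [Uq]]]]]].
move=> [oU oV C1h hUV [g [C1g gVU hK]]] hXV.
have Xbd x : boundary X x -> X x by case=> + _; rewrite -(closure_id _).1.
have ghq : g (h q) = q by rewrite hK ?inE.
have Vhq : V (h q) by rewrite -hUV; exists q.
have hq0 (i : 'I_n) : (n.-1 <= i)%N -> h q ord0 i = 0.
  move: i; have : (h @` (boundary X `&` W `&` U)) (h q) by exists q.
  by rewrite hXV => -[].
have [dh _] := C1h _ Uq; have [dg _] := C1g _ Vhq.
(* the directions e_i with i < n-1 are tangent to the boundary in the chart *)
have tangent m e : outer_normal X q m ->
    (forall i : 'I_n, (n.-1 <= i)%N -> e ord0 i = 0) ->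
    dotv m ('d g (h q) e) <= 0.
  move=> mq e0; apply: (@outer_normal_diff X) => //; first by rewrite ghq.
  have Vt : \forall t \near (0 : R), V (h q + t *: e).
    have : (fun t : R => h q + t *: e) @ 0 --> h q.
      rewrite -[X in _ --> X]addr0 -[X in _ + X](scale0r e).
      by apply: cvgD; [exact: cvg_cst | apply: cvgZl; exact: cvg_id].
    by apply; exact: open_nbhs_nbhs.
  apply: filterS Vt => t Vt.
  have [x [[bx _] Ux] hx] : (h @` (boundary X `&` W `&` U)) (h q + t *: e).
    by rewrite hXV; split => // i ni; rewrite !mxE hq0// e0// mulr0 addr0.
  by rewrite -hx hK ?inE//; exact: Xbd.
have tangent0 m e : outer_normal X q m ->
    (forall i : 'I_n, (n.-1 <= i)%N -> e ord0 i = 0) ->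
    dotv m ('d g (h q) e) = 0.
  move=> mq e0; apply/eqP; rewrite eq_le tangent//=.
  rewrite -oppr_le0 -dotvNr -linearN tangent// => i ni.
  by rewrite mxE e0// oppr0.
have [r r0 rX] := outer_normal_interior _ _ s0X.
move=> m m' mq m'q m1 m'1.
(* In dimension zero the only vector has norm 0, so the unit vector [m] guarantees a last
   coordinate. *)
have n0 : (0 < n)%N.
  rewrite lt0n; apply/eqP => n0; have /eqP[] := oner_neq0 R.
  rewrite -m1 /enorm /dotv big1 ?sqrtr0// => i _.
  by have := ltn_ord i; rewrite [X in (_ < X)%N]n0.
have ln : (n.-1 < n)%N by rewrite prednK.
pose l := Ordinal ln; pose e := delta_mx ord0 l : 'rV[R]_n.
have lineG p y : outer_normal X q p ->
    dotv p ('d g (h q) y) = y ord0 l * dotv p ('d g (h q) e).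
  move=> pq; have := tangent0 p (y - y ord0 l *: e) pq.
  rewrite [in dotv _ _]linearB (linearZZ ('d g (h q))) dotvDr dotvNr dotvZr => t0.
  apply/subr0_eq/t0 => i ni.
  have -> : i = l by apply/val_inj/eqP; rewrite eqn_leq ni -ltnS prednK// ltn_ord.
  by rewrite !mxE !eqxx mulr1 subrr.
(* hence every outer normal at q is a multiple of the gradient of the last
   coordinate of h, and the interior point s0 decides on which side it lies *)
have line p : outer_normal X q p ->
    forall v, dotv p v = 'd h q v ord0 l * dotv p ('d g (h q) e).
  move=> pq v; rewrite -(lineG p _ pq) (diff_cancel _ _ _ v dh dg)//.
  by apply: filterS (open_nbhs_nbhs (conj oU Uq)) => y Uy; rewrite hK ?inE.
(* With [c] the inner product of the two unit normals, these instances force [c ^+ 2 = 1]. Both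
   normals pair negatively with [s0 - q], so [c = 1] and the squared distance [2 - 2 * c]
   vanishes. *)
have := line m mq m; have := line m mq m'; have := line m' m'q m'.
have := line m' m'q m; have := line m mq (s0 - q); have := line m' m'q (s0 - q).
have := rX _ _ mq m1; have := rX _ _ m'q m'1.
rewrite -!enorm_sqr m1 m'1 (dotvC m' m).
set c := dotv m m'; set a := dotv m ('d g (h q) e); set b := dotv m' ('d g (h q) e).
set k := 'd h q _ ord0 l; set x := 'd h q m ord0 l; set x' := 'd h q m' ord0 l.
move=> sr' sr ks' ks E1 E2 E3 E4.
have ba : b = c * a by rewrite E1 mulrAC -E4; ring.
have ab : a = c * b by rewrite E3 mulrAC -E2; ring.
have a0 : a != 0 by apply/eqP => a0; move/eqP: E4; rewrite a0 mulr0 expr1n oner_eq0.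
have c2 : c ^+ 2 = 1 by apply: (mulIf a0); rewrite mul1r [RHS]ab ba; ring.
have c0 : 0 < c.
  have : 0 < dotv m (s0 - q) * dotv m' (s0 - q) by nra.
  rewrite ks ks' ba; have := sqr_ge0 (k * a).
  by rewrite le0r => /orP[/eqP|]; nra.
have c1 : c = 1 by nra.
apply/eqP; rewrite -subr_eq0 -enorm_eq0 -sqrf_eq0 enorm_sqr.
by rewrite !dotvE (dotvC m' m) -!enorm_sqr m1 m'1 -/c c1; apply/eqP; ring.
Qed.

End normals.

(** * Stability of normals, and metric projection onto closed convex sets *)

Section closed_convex.
Context {R : realType} {n : nat}.
Implicit Types (X C : set 'rV[R]_n) (m p q s : 'rV[R]_n).

(** If a unit [m] is not normal at [q], some [x] in [X] has [dotv m (x - q) > 0]. This persists for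
    nearby [m] and [q], and compactness of the unit sphere yields one neighborhood of [q] valid for
    all [m]. *)
Lemma outer_normal_near X q :
  (forall m m', outer_normal X q m -> outer_normal X q m' ->
    enorm m = 1 -> enorm m' = 1 -> m = m') ->
  exists nu, forall eta, 0 < eta -> exists2 d, 0 < d & forall p m,
    enorm (p - q) < d -> outer_normal X p m -> enorm m = 1 ->
    enorm (m - nu) < eta.
Proof.
move=> uniq; pose N := [set m | outer_normal X q m /\ enorm m = 1].
(* If [q] has no unit normal, [get N] is a default vector; the covering only needs that no other
   unit vector is normal at [q]. *)
exists (get N) => eta eta0.
have sphere : compact [set m : 'rV[R]_n | enorm m = 1].
  apply: bounded_closed_compact.
    exists 1; split=> // M M1 m /= m1.
    by rewrite (le_trans (norm_le_enorm m))// m1 ltW.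
  by apply: (@closed_comp _ _ (@enorm R n) [set x | x = 1]);
    [move=> ? _; exact: enorm_continuous | exact: closed_eq].
have near_sphere : \forall p \near q, [set m : 'rV[R]_n | enorm m = 1] `<=`
    [set m | outer_normal X p m -> enorm (m - get N) < eta].
  have cov := (compact_near_coveringP _).1 sphere.
  apply: (cov _ (nbhs q) (fun p m => outer_normal X p m -> enorm (m - get N) < eta)).
  move=> m /= m1.
  have [mN|mN] := eqVneq m (get N).
    have mc : {for m, continuous (fun x : 'rV[R]_n => x - get N)}.
      by apply: continuousB; [exact: cvg_id | exact: cst_continuous].
    have : enorm (x - get N) @[x --> m] --> (0 : R).
      have <- : enorm (m - get N) = 0 by apply/eqP; rewrite enorm_eq0 subr_eq0 -mN.
      exact: (continuous_comp mc (enorm_continuous _)).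
    move=> /cvgr_lt /(_ _ eta0) {}mc; exists ([set x | enorm (x - get N) < eta], setT).
      by split=> //; exact: filterT.
    by move=> -[x p] [].
  have [x Xx mx] : exists2 x, X x & 0 < dotv m (x - q).
    apply: contrapT => nx; have mq : outer_normal X q m.
      by move=> x Xx; rewrite leNgt; apply/negP => mx; apply: nx; exists x.
    have [gq g1] : N (get N) by apply: (@getPex _ N); exists m.
    by move/eqP: mN; apply; exact: uniq.
  have : {for (m, q), continuous (fun z : 'rV[R]_n * 'rV[R]_n => dotv z.1 (x - z.2))}.
    apply: dotv_continuous; first exact: cvg_fst.
    by apply: continuousB; [exact: cst_continuous | exact: cvg_snd].
  move=> /cvgr_gt /(_ _ mx); apply: filterS => -[m' p'] /= + /(_ _ Xx).
  by move=> /lt_le_trans /[apply]; rewrite ltxx.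
have [d d0 dP] := enorm_nbhs _ _ near_sphere.
by exists d => // p m pq mp m1; exact: dP pq _ m1 mp.
Qed.

Lemma convex_set_line C x y t : convex_set C -> C x -> C y -> 0 <= t <= 1 ->
  C (x + t *: (y - x)).
Proof.
move=> cC Cx Cy /andP[t0 t1].
have := cC y x (Itv01 t0 t1); rewrite !inE => /(_ Cy Cx).
rewrite [X in C X -> _](_ : _ = x + t *: (y - x))//.
by rewrite /conv/= scalerBl scale1r scalerBr addrCA.
Qed.

Lemma dist_set_le C z y : C y -> dist_set z C <= enorm (z - y).
Proof.
move=> Cy; apply: ge_inf; last by exists y.
by exists 0 => _ [x _ <-]; exact: enorm_ge0.
Qed.

Lemma dist_set_ge C z d : C !=set0 -> (forall y, C y -> d <= enorm (z - y)) ->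
  d <= dist_set z C.
Proof.
move=> [y Cy] dC; apply: lb_le_inf; first by exists (enorm (z - y)), y.
by move=> _ [x Cx <-]; exact: dC.
Qed.

(** The distance to [z] attains its minimum on the compact part of [C] no farther from [z] than
    [y0]; the rest of [C] is farther away. *)
Lemma nearest_point_exists C z : closed C -> C !=set0 ->
  exists p, C p /\ enorm (z - p) = dist_set z C.
Proof.
move=> cC [y0 Cy0].
have dc : continuous (fun y : 'rV[R]_n => enorm (z - y)).
  move=> y; have zc : {for y, continuous (fun y : 'rV[R]_n => z - y)}.
    by apply: continuousB; [exact: cst_continuous | exact: cvg_id].
  exact: (continuous_comp zc (enorm_continuous _)).
pose A := C `&` [set y | enorm (z - y) <= enorm (z - y0)].
have [] := @compact_EVT_min _ _ (fun y : 'rV[R]_n => enorm (z - y)) A.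
- by exists y0; split => /=.
- apply: bounded_closed_compact.
    exists (enorm z + enorm (z - y0)); split; first exact: num_real.
    move=> M M1 y [_ /= yz]; apply: (le_trans (norm_le_enorm y)); apply: ltW.
    apply: le_lt_trans M1; have := enormD_le z (y - z).
    by rewrite addrC subrK enormB; lra.
  apply: closedI => //.
  by apply: (@closed_comp _ _ (fun y : 'rV[R]_n => enorm (z - y))
    [set x | x <= enorm (z - y0)]); [move=> ? _; exact: dc | exact: closed_le].
- exact: continuous_subspaceT.
move=> p; rewrite inE => -[Cp pz] pmin; exists p; split=> //.
apply/eqP; rewrite eq_le dist_set_le// andbT; apply: dist_set_ge; first by exists p.
move=> y Cy; have [yz|/ltW yz] := leP (enorm (z - y)) (enorm (z - y0)).
  by apply: pmin; rewrite inE.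
exact: le_trans yz.
Qed.

(** If some [y] made an acute angle at the nearest point [p], a short move from [p] towards [y]
    would come closer to [z]. *)
Lemma metric_projP C z : closed C -> C !=set0 -> convex_set C ->
  C (metric_proj C z) /\ outer_normal C (metric_proj C z) (z - metric_proj C z).
Proof.
move=> cC C0 vC.
have [q Cq] := nearest_point_exists C z cC C0.
have := @getPex _ [set p | C p /\ enorm (z - p) = dist_set z C] (ex_intro _ q Cq).
rewrite -/(metric_proj C z); set p := metric_proj C z => -[Cp pz].
split=> // y Cy; rewrite leNgt; apply/negP; set d := dotv _ _ => d0.
pose D := dotv (y - p) (y - p); have D0 : 0 <= D := dotv_ge0 _.
have dD : 0 < d + D by rewrite ltr_wpDr.
(* A step [t] changes the squared distance by [t * (t * D - 2 * d)]. The choice [d / (d + D)] makes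
   [t * D] less than [d] and is safe even when [D] is zero. *)
have t01 : 0 <= d / (d + D) <= 1.
  by rewrite (divr_ge0 (ltW d0) (ltW dD)) ler_pdivrMr// mul1r lerDl.
have := dist_set_le _ z _ (convex_set_line _ _ _ _ vC Cp Cy t01).
rewrite -pz enorm_le opprD addrA.
have expand u v t : dotv (u - t *: v) (u - t *: v) =
    dotv u u - t * (2 * dotv u v - t * dotv v v).
  by rewrite !dotvE (dotvC v u); ring.
rewrite expand -/D -/d lerBrDr gerDl pmulr_rle0 ?divr_gt0//.
have -> : d / (d + D) * D = d - d / (d + D) * d by field; rewrite gt_eqF.
have : d / (d + D) * d >= 0 by rewrite mulr_ge0 ?divr_ge0 ?ltW.
lra.
Qed.

Lemma metric_proj_unique C z p : closed C -> convex_set C ->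
  C p -> outer_normal C p (z - p) -> metric_proj C z = p.
Proof.
move=> cC vC Cp pz.
have [Cq qz] := metric_projP _ z cC (ex_intro _ p Cp) vC.
have := pz _ Cq; have := qz _ Cp; set q := metric_proj C z => h1 h2.
apply/eqP; rewrite -subr_eq0 -enorm_eq0 -sqrf_eq0 eq_le sqr_ge0 andbT enorm_sqr.
move: h1 h2; rewrite !dotvE (dotvC q p); lra.
Qed.

Lemma metric_proj_le C z s : closed C -> convex_set C -> C s ->
  enorm (metric_proj C z - s) <= enorm (z - s).
Proof.
move=> cC vC Cs; have [_ /(_ _ Cs)] := metric_projP _ z cC (ex_intro _ s Cs) vC.
set p := metric_proj C z => h; rewrite enorm_le.
have := dotv_ge0 (z - p); move: h.
rewrite !dotvE (dotvC p z) (dotvC s z) (dotvC s p); lra.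
Qed.

End closed_convex.

(** * The circumcenter as a projection onto an intersection of half-spaces *)

Section circumcenter.
Context {R : realType} {n : nat}.
Implicit Types (w p s c : 'rV[R]_n).

(** The bisector of [w] and its reflection through [p] is the hyperplane through [p] with normal
    [w - p]; this makes the circumcenter conditions linear. *)
Lemma enorm_reflect w p c : (enorm (c - w) = enorm (c - (2%:R *: p - w))) <->
  dotv (w - p) (c - p) = 0.
Proof.
rewrite enorm_eq; have -> : dotv (c - w) (c - w) =
    dotv (c - (2%:R *: p - w)) (c - (2%:R *: p - w)) - 4 * dotv (w - p) (c - p).
  by rewrite !dotvE (dotvC p c) (dotvC w c) (dotvC w p); ring.
split=> h; lra.
Qed.

(** A zero Gram determinant would make [w - p] and [w - p'] parallel, hence opposite by the obtuse
    angle, and the two half-spaces could not share the point [s]. *)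
Lemma gram_gt0 w p p' s : w != p -> w != p' -> dotv (w - p) (w - p') <= 0 ->
  dotv (w - p) (s - p) <= 0 -> dotv (w - p') (s - p') <= 0 ->
  0 < dotv (w - p) (w - p) * dotv (w - p') (w - p') - dotv (w - p) (w - p') ^+ 2.
Proof.
rewrite -(subr_eq0 w p) -(subr_eq0 w p') => a0 b0.
have -> : s - p = s - w + (w - p) by rewrite addrA subrK.
have -> : s - p' = s - w + (w - p') by rewrite addrA subrK.
move: (w - p) (w - p') (s - w) a0 b0 => a b v a0 b0 ab0.
have aa := dotv_gt0 _ a0; have bb := dotv_gt0 _ b0; rewrite !dotvDr => va vb.
rewrite lt0r subr_ge0 dotv_sqr_le andbT subr_eq0; apply/eqP => G0.
have /eqP : dotv b b *: a - dotv a b *: b == 0.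
  rewrite -enorm_eq0 -sqrf_eq0 enorm_sqr !dotvE (dotvC b a); apply/eqP.
  transitivity (dotv b b * (dotv a a * dotv b b - dotv a b ^+ 2)); first by ring.
  by rewrite G0 subrr mulr0.
move/(congr1 (fun x => dotv x v)); rewrite /= !dotvE (dotvC 0) dotv0 => /eqP.
rewrite subr_eq0 => /eqP; nra.
Qed.

(** The point [c] is the projection of [w] onto the intersection of the two half-spaces; the last
    inequality is Pythagoras with an obtuse angle at [c]. *)
Lemma circP w p p' : w != p -> w != p' -> dotv (w - p) (w - p') <= 0 ->
  (exists s, dotv (w - p) (s - p) <= 0 /\ dotv (w - p') (s - p') <= 0) ->
  let c := circ w (2%:R *: p - w) (2%:R *: p' - w) in
  [/\ dotv (w - p) (c - p) = 0, dotv (w - p') (c - p') = 0 &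
    forall s, dotv (w - p) (s - p) <= 0 -> dotv (w - p') (s - p') <= 0 ->
      dotv (c - s) (c - s) + dotv (c - w) (c - w) <= dotv (w - s) (w - s)].
Proof.
move=> wp wp' ab0 [s0 [ps0 ps0']] c.
have G0 := gram_gt0 _ _ _ _ wp wp' ab0 ps0 ps0'.
have wB q x : x - q = w - q - (w - x) by rewrite opprB [RHS]addrC subrKA.
have coplanar x y z : x + y + z = 1 ->
    x *: w + y *: (2%:R *: p - w) + z *: (2%:R *: p' - w) =
    w - ((2 * y) *: (w - p) + (2 * z) *: (w - p')).
  move=> /(canRL (addrK _))/(canRL (addrK _)) ->.
  by apply/rowP => i; rewrite !mxE; ring.
move: wp wp'; rewrite -(subr_eq0 w p) -(subr_eq0 w p').
move aE: (w - p) ab0 ps0 G0 coplanar => a; move bE: (w - p') ps0' => b.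
move=> ps0' ab0 ps0 G0 coplanar /dotv_gt0 aa /dotv_gt0 bb.
set G := _ - _ in G0.
have orth x y : let d := w - (x *: a + y *: b) in
    dotv a (d - p) = dotv a a - x * dotv a a - y * dotv a b /\
    dotv b (d - p') = dotv b b - x * dotv a b - y * dotv b b.
  by rewrite /= (wB p) (wB p') aE bE subKr !dotvE (dotvC b a); split; ring.
have cP : is_circumcenter w (2%:R *: p - w) (2%:R *: p' - w) c.
  apply: (@getPex _ (is_circumcenter w (2%:R *: p - w) (2%:R *: p' - w))).
  (* Cramer's rule for the system obtained by setting both expressions in [orth] to zero; its
     determinant is the Gram determinant [G]. *)
  pose x := dotv b b * (dotv a a - dotv a b) / G.
  pose y := dotv a a * (dotv b b - dotv a b) / G.
  exists (w - (x *: a + y *: b)); have [e1 e2] := orth x y.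
  have wd : enorm (w - (x *: a + y *: b) - w) =
      enorm (w - (x *: a + y *: b) - (2%:R *: p - w)).
    by apply/enorm_reflect; rewrite aE e1 /x /y /G; field; rewrite gt_eqF.
  split=> //; last first.
    rewrite -wd; apply/enorm_reflect; rewrite bE e2 /x /y /G.
    by field; rewrite gt_eqF.
  exists (1 - x / 2 - y / 2), (x / 2), (y / 2); split; first by ring.
  rewrite coplanar; last by ring.
  by congr (_ - (_ *: _ + _ *: _)); field.
have [[x [y [z [xyz cE]]]] e1 e2] := cP.
move: (e1) => /enorm_reflect ac; move: e2; rewrite -e1 => /enorm_reflect bc.
rewrite aE in ac; rewrite bE in bc; split=> // s ps ps'.
rewrite coplanar// in cE.
move: (2 * y) (2 * z) cE => {x y z xyz e1} x y cE.
have [] := orth x y; rewrite /= -cE ac bc => E1 E2.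
(* c = w - x a - y b with x, y >= 0, so w - c is an outer normal at c of the
   intersection of the two half-spaces *)
have x0 : 0 <= x.
  rewrite -(pmulr_lge0 _ G0).
  have -> : x * G = dotv b b * (dotv a a - dotv a b) by rewrite /G; nra.
  by rewrite mulr_ge0 ?ltW// subr_gt0; exact: le_lt_trans aa.
have y0 : 0 <= y.
  rewrite -(pmulr_lge0 _ G0).
  have -> : y * G = dotv a a * (dotv b b - dotv a b) by rewrite /G; nra.
  by rewrite mulr_ge0 ?ltW// subr_gt0; exact: le_lt_trans bb.
have as_ : dotv a (s - c) <= 0.
  by move: ps ac; rewrite !dotvE; lra.
have bs_ : dotv b (s - c) <= 0.
  by move: ps' bc; rewrite !dotvE; lra.
have : dotv (w - c) (s - c) <= 0.
  by rewrite cE subKr -cE dotvDl !dotvZl; nra.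
rewrite !dotvE (dotvC s c) (dotvC w c) (dotvC w s); lra.
Qed.

End circumcenter.

(** * Pushing points into a smooth convex set, and centralized points *)

Section steps.
Context {R : realType} {n : nat}.
Implicit Types (X Y : set 'rV[R]_n) (p q s c w u : 'rV[R]_n).

(* If the point were outside X, a unit normal separating it from X would differ
   from m by more than eps * r, where r measures how deep s lies in X. *)
Lemma smooth_push X q s eps : closed X -> convex_set X -> X° s ->
  (forall m m', outer_normal X q m -> outer_normal X q m' ->
    enorm m = 1 -> enorm m' = 1 -> m = m') -> 0 < eps ->
  exists2 d, 0 < d & forall p m c rho, X p -> outer_normal X p m ->
    enorm m = 1 -> enorm (p - q) < d -> enorm (c - q) < d ->
    enorm (c - p) <= rho -> rho < d -> dotv m (c - p) <= 0 ->
    X (c + (eps * rho) *: (s - c)).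
Proof.
move=> cX vX sX uniq eps0.
have Xs := interior_subset sX.
have [r r0 rX] := outer_normal_interior _ _ sX.
have [nu nuP] := outer_normal_near _ _ uniq.
(* Half of [eps * r], since two normals will each be compared with [nu]. *)
have eta0 : 0 < eps * r / 2 by rewrite !divr_gt0 ?mulr_gt0.
have [d0 d00 dP] := nuP _ eta0.
have M0 := enorm_ge0 (s - q); set M := enorm (s - q) in M0.
have K0 : 0 < 1 + eps * (M + 1) by rewrite ltr_wpDr// mulr_ge0 ?ltW// ltr_wpDl.
(* The bound 1 gives [enorm (s - c) <= M + 1], the bound [eps^-1] keeps [eps * rho] below 1, and the
   last one keeps both [p] and the shifted point within [d0] of [q]. *)
exists (Num.min (Num.min 1 eps^-1) (d0 / (1 + eps * (M + 1)))).
  by rewrite !lt_min ltr01 invr_gt0 eps0 divr_gt0.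
move=> p m c rho Xp pm m1; rewrite !lt_min -!andbA.
move=> /and3P[_ _ pd] /and3P[cd1 _ cd] cp /and3P[_ rho1 rhod] mcp.
have rho0 : 0 <= rho by exact: le_trans (enorm_ge0 _) cp.
have tau0 : 0 <= eps * rho by rewrite mulr_ge0// ltW.
have tau1 : eps * rho < 1 by rewrite mulrC -ltr_pdivlMr// div1r.
set y := c + _; apply: contrapT => Xy.
have [XP nP] := metric_projP _ y cX (ex_intro _ s Xs) vX.
have yP0 : y - metric_proj X y != 0.
  by rewrite subr_eq0; apply: contra_not_neq Xy => ->.
set P := metric_proj X y in XP nP yP0; set l := enorm (y - P).
have l0 : 0 < l by rewrite enorm_gt0.
pose m' := l^-1 *: (y - P).
have m'1 : enorm m' = 1 by rewrite enormZ gtr0_norm ?invr_gt0// mulVf// gt_eqF.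
have sep x : X x -> dotv m' (x - y) < 0.
  move=> Xx; rewrite dotvZl pmulr_rlt0 ?invr_gt0//.
  have := nP _ Xx; have := dotv_gt0 _ yP0.
  by rewrite !dotvE; lra.
have m'y : outer_normal X y m' by move=> x /sep/ltW.
clearbody m'.
have yc : y - c = (eps * rho) *: (s - c) by rewrite /y addrAC subrr add0r.
have yq : enorm (y - q) < d0.
  have := enorm_dist_triangle c y q; rewrite yc enormZ ger0_norm//.
  have := enorm_dist_triangle q s c; rewrite (enormB q c) -/M => sc yqle.
  have : eps * rho * enorm (s - c) <= eps * (d0 / (1 + eps * (M + 1))) * (M + 1).
    by apply: ler_pM; rewrite ?enorm_ge0// ?ler_pM2l ?ltW//; lra.
  suff : d0 / (1 + eps * (M + 1)) + eps * (d0 / (1 + eps * (M + 1))) * (M + 1) = d0.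
    by move=> dE h; lra.
  by field; rewrite gt_eqF.
have pd0 : enorm (p - q) < d0.
  apply: lt_le_trans pd _; rewrite ler_pdivrMr// ler_pMr// lerDl.
  by rewrite mulr_ge0 ?ltW// ltr_wpDl.
have m'm : enorm (m' - m) < eps * r.
  have := enorm_dist_triangle nu m' m; rewrite (enormB nu m).
  have := dP _ _ yq m'y m'1; have := dP _ _ pd0 pm m1; lra.
(* Strict separation at [p] requires [dotv m' (y - p) > 0]. But [dotv m' (c - p)] is at most
   [eps * r * rho], and the move towards [s] lowers it by at least that much. *)
have := rX _ _ m'y m'1; have := sep _ Xp; have := dotv_le_enorm (m' - m) (c - p).
move: mcp; rewrite /y !dotvE.
move: (dotv m' s) (dotv m' c) (dotv m' p) (dotv m c) (dotv m p) => S' C' P' C0 P0.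
move: (enorm_ge0 (m' - m)) (enorm_ge0 (c - p)) cp m'm tau0 tau1 => + + + + + +.
move: (enorm (m' - m)) (enorm (c - p)) => N L N0 L0 Lrho Nr tau0 tau1 h1 h2 h3 h4.
have h5 : N * L <= eps * r * rho by apply: ler_pM => //; exact: ltW.
(* The depth bound is known at [y]; since [s - y] is [s - c] scaled by a factor in (0,1], it carries
   over to [c]. *)
have h6 : S' - C' <= - r.
  rewrite leNgt; apply/negP => h6.
  have : (1 - eps * rho) * (S' - C') <= - r by lra.
  have [B0|/ltW B0] := lerP 0 (S' - C').
    have : 0 <= (1 - eps * rho) * (S' - C') by rewrite mulr_ge0// subr_ge0 ltW.
    by lra.
  have : eps * rho * (S' - C') <= 0 by rewrite mulr_ge0_le0.
  by lra.
have h7 : eps * rho * (S' - C') <= eps * rho * - r by rewrite ler_wpM2l.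
lra.
Qed.

(** Both reflections fix [w], so the affine hull of the three points is [w] alone. *)
Lemma PCRM_fixed X Y w : closed X -> closed Y -> convex_set X -> convex_set Y ->
  (X `&` Y) w -> PCRM X Y w = w.
Proof.
move=> cX cY vX vY [Xw Yw].
have w0 C : outer_normal C w (w - w).
  by move=> x _; rewrite subrr dotvC dotv0.
rewrite /PCRM /reflection !(metric_proj_unique _ w w)//.
have -> : 2%:R *: w - w = w by rewrite scaler_nat mulr2n addrK.
have [|[a [b [c [abc cE]]] _ _]] := @getPex _ (is_circumcenter w w w).
  exists w; split=> //; exists 1, 0, 0; split; first by ring.
  by rewrite scale1r !scale0r !addr0.
by rewrite /circ cE -!scalerDl abc scale1r.
Qed.

(** The point [w] lies strictly between [u] and its projection on [X], so it keeps that projection.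
    As [u] projects a point of [X], [w] is outside [Y], and testing its projection on [Y] against
    [u] gives the obtuse angle. *)
Lemma centralizer_step X Y u x alpha : closed X -> closed Y ->
  convex_set X -> convex_set Y -> X `&` Y !=set0 ->
  X x -> metric_proj Y x = u -> ~ X u -> 0 < alpha < 1 ->
  let w := alpha *: u + (1 - alpha) *: metric_proj X u in
  [/\ w != metric_proj X w, w != metric_proj Y w &
    dotv (w - metric_proj X w) (w - metric_proj Y w) <= 0].
Proof.
move=> cX cY vX vY [s [Xs Ys]] Xx xu Xu /andP[a0 a1].
have [Yu nu] := metric_projP _ x cY (ex_intro _ s Ys) vY; rewrite xu in Yu nu.
have [Xq nq] := metric_projP _ u cX (ex_intro _ x Xx) vX.
set q := metric_proj X u in Xq nq *; move=> w.
have uq0 : u - q != 0 by rewrite subr_eq0; apply: contra_not_neq Xu => ->.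
have uq := dotv_gt0 _ uq0.
have wq : w - q = alpha *: (u - q).
  by apply/rowP => i; rewrite !mxE; ring.
have uw : u - w = (1 - alpha) *: (u - q).
  by apply/rowP => i; rewrite !mxE; ring.
clearbody w q; have pX : metric_proj X w = q.
  apply: metric_proj_unique => // y Xy.
  by rewrite wq dotvZl pmulr_rle0// nq.
(* x - u is an outer normal of Y at u at an obtuse angle to u - q, and w - u is
   a negative multiple of u - q *)
have Yw : ~ Y w.
  move=> /nu; rewrite -(opprB u w) uw dotvNr dotvZr oppr_le0 pmulr_rge0 ?subr_gt0//.
  have := nq _ Xx.
  have -> : x - q = x - u + (u - q) by rewrite addrA subrK.
  by rewrite dotvDr (dotvC (u - q) (x - u)); lra.
have [Yp np] := metric_projP _ w cY (ex_intro _ s Ys) vY.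
have wp0 : w - metric_proj Y w != 0.
  by rewrite subr_eq0; apply: contra_not_neq Yw => ->.
have wp := dotv_gt0 _ wp0.
rewrite pX; split; first by rewrite -subr_eq0 wq scaler_eq0 negb_or gt_eqF.
  by rewrite -subr_eq0.
have := np _ Yu.
have -> : u - metric_proj Y w = (u - w) + (w - metric_proj Y w).
  by rewrite addrA subrK.
rewrite wq uw dotvDr dotvZr dotvZl pmulr_rle0// (dotvC _ (u - q)) => h.
have : (1 - alpha) * dotv (u - q) (w - metric_proj Y w) <= 0 by lra.
by rewrite pmulr_rle0// subr_gt0.
Qed.

End steps.

(** * One full step of the method, and the convergence rates *)

Section iteration.
Context {R : realType} {n : nat}.
Implicit Types (X Y C : set 'rV[R]_n) (p s c w u : 'rV[R]_n).

(** The point [p] stands for the projection of [w] on [C]. The clauses put [c] on a supporting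
    hyperplane at [p] and bound [p] through [w], in the form [smooth_push] consumes. *)
Definition supported C w c := exists p m, [/\ C p /\ outer_normal C p m,
  enorm m = 1, dotv m (c - p) = 0, enorm (c - p) <= enorm (c - w) &
  forall s, C s -> enorm (p - s) <= enorm (w - s)].

Lemma supported_metric_proj C w c : closed C -> convex_set C -> C !=set0 ->
  w != metric_proj C w -> dotv (w - metric_proj C w) (c - metric_proj C w) = 0 ->
  supported C w c.
Proof.
move=> cC vC C0 wp0 cp; have [Cp np] := metric_projP _ w cC C0 vC.
have ple s : C s -> enorm (metric_proj C w - s) <= enorm (w - s).
  by move=> Cs; exact: metric_proj_le.
move: (metric_proj C w) wp0 cp Cp np ple => p; rewrite -subr_eq0 => wp0 cp Cp np ple.
have wp : 0 < enorm (w - p) by rewrite enorm_gt0.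
exists p, ((enorm (w - p))^-1 *: (w - p)); split=> //.
- by split=> // x Cx; rewrite dotvZl pmulr_rle0 ?invr_gt0//; exact: np.
- by rewrite enormZ gtr0_norm ?invr_gt0// mulVf// gt_eqF.
- by rewrite dotvZl cp mulr0.
rewrite enorm_le; have -> : c - w = c - p - (w - p) by rewrite opprB addrA subrK.
have := dotv_ge0 (w - p); move: (w - p) (c - p) cp => a b ab.
by rewrite !(dotvDl b) !(dotvDr _ b) !dotvNl !dotvNr (dotvC b a) ab; lra.
Qed.

(** If [u] is in [X], then [w] and [c] both equal [u], a common point. Otherwise [circP] applies,
    and dropping either square from its last inequality gives the two distance bounds on [c]. *)
Lemma PCRM_step X Y u x alpha : closed X -> closed Y ->
  convex_set X -> convex_set Y -> X `&` Y !=set0 ->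
  X x -> metric_proj Y x = u -> 0 < alpha < 1 ->
  let w := alpha *: u + (1 - alpha) *: metric_proj X u in
  let c := PCRM X Y w in
  (forall s, (X `&` Y) s -> enorm (w - s) <= enorm (u - s) /\
     enorm (c - s) <= enorm (w - s)) /\
  ((X `&` Y) c \/ [/\ supported X w c, supported Y w c &
     forall s, (X `&` Y) s -> enorm (c - w) <= enorm (w - s)]).
Proof.
move=> cX cY vX vY S0 Xx xu a01 w c; have [s0 [Xs0 Ys0]] := S0.
have wu s : (X `&` Y) s -> enorm (w - s) <= enorm (u - s).
  move=> [Xs Ys]; have /andP[a0 a1] := a01.
  have -> : w - s = alpha *: (u - s) + (1 - alpha) *: (metric_proj X u - s).
    by apply/rowP => i; rewrite !mxE; ring.
  apply: le_trans (enormD_le _ _) _; rewrite !enormZ (ger0_norm (ltW a0)).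
  rewrite (@ger0_norm _ (1 - alpha)); last by rewrite subr_ge0 ltW.
  have := metric_proj_le _ u _ cX vX Xs; rewrite -subr_ge0 => ab.
  have : 0 <= (1 - alpha) * (enorm (u - s) - enorm (metric_proj X u - s)).
    by rewrite mulr_ge0// subr_ge0 ltW.
  by lra.
have [Yu nu] := metric_projP _ x cY (ex_intro _ s0 Ys0) vY; rewrite xu in Yu nu.
have [Xu|Xu] := pselect (X u).
  have wE : w = u.
    rewrite /w (metric_proj_unique _ u u)//; last first.
      by move=> y _; rewrite subrr dotvC dotv0.
    by rewrite -scalerDl addrC subrK scale1r.
  have cE : c = u by rewrite /c wE PCRM_fixed.
  by split=> [s Ss|]; [rewrite cE wE | left; rewrite cE].
have [wX wY ab] := centralizer_step _ _ _ _ _ cX cY vX vY S0 Xx xu Xu a01.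
have sX s : (X `&` Y) s -> dotv (w - metric_proj X w) (s - metric_proj X w) <= 0.
  by move=> [Xs _]; exact: (metric_projP _ w cX (ex_intro _ x Xx) vX).2.
have sY s : (X `&` Y) s -> dotv (w - metric_proj Y w) (s - metric_proj Y w) <= 0.
  by move=> [_ Ys]; exact: (metric_projP _ w cY (ex_intro _ u Yu) vY).2.
have [] := circP _ _ _ wX wY ab.
  by exists s0; split; [exact: sX | exact: sY].
rewrite -[circ _ _ _]/c => cpX cpY cs.
split=> [s Ss|].
  split; first exact: wu.
  rewrite enorm_le; have := cs _ (sX _ Ss) (sY _ Ss).
  by have := dotv_ge0 (c - w); lra.
right; split.
- by apply: supported_metric_proj => //; exists x.
- by apply: supported_metric_proj => //; exists u.
move=> s Ss; rewrite enorm_le; have := cs _ (sX _ Ss) (sY _ Ss).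
by have := dotv_ge0 (c - s); lra.
Qed.

End iteration.

(* When n = 0 every boundary is empty, so n.-1 is only used for n >= 1. *)
Theorem theorem4p9 (R : realType) (n : nat) (X Y : set 'rV[R]_n)
  (closedX : closed X) (convexX : convex_set X)
  (closedY : closed Y) (convexY : convex_set Y)
  (S_neq0 : X `&` Y !=set0)
  (T : 'rV[R]_n -> 'rV[R]_n)
  (admT : admissible X Y T)
  (rangeT : range T `<=` metric_proj Y @` X)
  (alpha : nat -> R) (alpha01 : forall k, 0 < alpha k < 1)
  (z : nat -> 'rV[R]_n)
  (zS : forall k, z k.+1 = PCRM X Y (centralizer X T (alpha k) (z k)))
  (zbar : 'rV[R]_n) (z_cvg : z @ \oo --> zbar) (zbarS : (X `&` Y) zbar)
  (intS : (X `&` Y)° !=set0)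
  (zbar_bd : (boundary X `&` boundary Y) zbar)
  (smoothX : C1_submanifold_near n.-1 (boundary X) zbar)
  (smoothY : C1_submanifold_near n.-1 (boundary Y) zbar) :
  superlinear0 (fun k => dist_set (z k) (X `&` Y)) /\ superlinear z zbar.
Proof.
have [s0 s0S] := intS.
have s0X : X° s0 by apply: interiorS s0S; exact: subIsetl.
have s0Y : Y° s0 by apply: interiorS s0S; exact: subIsetr.
have uniqX := outer_normal_smooth _ _ closedX (ex_intro _ _ s0X) zbar_bd.1 smoothX.
have uniqY := outer_normal_smooth _ _ closedY (ex_intro _ _ s0Y) zbar_bd.2 smoothY.
pose w k := centralizer X T (alpha k) (z k).
have step k : (forall s, (X `&` Y) s -> enorm (w k - s) <= enorm (z k - s) /\
     enorm (z k.+1 - s) <= enorm (w k - s)) /\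
  ((X `&` Y) (z k.+1) \/ [/\ supported X (w k) (z k.+1), supported Y (w k) (z k.+1) &
     forall s, (X `&` Y) s -> enorm (z k.+1 - w k) <= enorm (w k - s)]).
  have [x Xx xT] : (metric_proj Y @` X) (T (z k)) by apply: rangeT; exists (z k).
  have [] := PCRM_step _ _ _ _ _ closedX closedY convexX convexY S_neq0 Xx xT (alpha01 k).
  rewrite -/(centralizer X T (alpha k) (z k)) -zS -/(w k) => wc alt; split=> // s Ss.
  by have [wT cw] := wc s Ss; split=> //; apply: le_trans wT _; exact: admT.2.
have fejer j k s : (X `&` Y) s -> enorm (z (k + j)%N - s) <= enorm (z k - s).
  move=> Ss; elim: j => [|j IH]; first by rewrite addn0.
  have [wz cw] := (step (k + j)%N).1 s Ss.
  by rewrite addnS (le_trans cw)// (le_trans wz).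
have near_zbar d : 0 < d -> \forall k \near \oo, enorm (z k - zbar) < d.
  move=> d0; have : enorm (z k - zbar) @[k --> \oo] --> (0 : R).
    have <- : enorm (zbar - zbar) = 0 by apply/eqP; rewrite enorm_eq0 subrr.
    apply: continuous_cvg; first exact: enorm_continuous.
    by apply: cvgB => //; exact: cvg_cst.
  by move=> /cvgr_lt; apply.
(* Letting the later iterates tend to [zbar] in [fejer] gives [enorm (s - zbar) <= enorm (z k - s)];
   the triangle inequality and an infimum over [s] finish. *)
have zbar_dist k : enorm (z k - zbar) <= 2 * dist_set (z k) (X `&` Y).
  rewrite mulrC -ler_pdivrMr//; apply: dist_set_ge => // s Ss.
  rewrite ler_pdivrMr//; have := enorm_dist_triangle s (z k) zbar.
  suff : enorm (s - zbar) <= enorm (z k - s) by lra.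
  apply/ler_addgt0Pr => e e0; have [N _ /(_ (k + N)%N)] := near_zbar _ e0.
  rewrite /= leq_addl => /(_ isT); have := fejer N k s Ss.
  have := enorm_dist_triangle (z (k + N)%N) s zbar.
  by rewrite (enormB s (z _)); lra.
have dist_zbar k : dist_set (z k) (X `&` Y) <= enorm (z k - zbar) by exact: dist_set_le.
have dist_ge0 k : 0 <= dist_set (z k) (X `&` Y).
  by apply: dist_set_ge => // s _; exact: enorm_ge0.
have rate eps : 0 < eps -> \forall k \near \oo,
    dist_set (z k.+1) (X `&` Y) <= eps * dist_set (z k) (X `&` Y).
  move=> eps0; have M0 : 0 < enorm (s0 - zbar) + 1 by rewrite ltr_wpDl ?enorm_ge0.
  (* The denominator bounds the distance from [s0] to the new iterate once [z k] is within 1 of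
     [zbar], so the displacement will have length at most [eps * rho]. *)
  have e0 : 0 < eps / (enorm (s0 - zbar) + 1) by rewrite divr_gt0.
  have [dX dX0 pushX] := smooth_push _ _ _ _ closedX convexX s0X uniqX e0.
  have [dY dY0 pushY] := smooth_push _ _ _ _ closedY convexY s0Y uniqY e0.
  near=> k.
  have [zw [zS1|[suppX suppY cw]]] := step k.
    apply: le_trans (dist_set_le _ _ _ zS1) _.
    have -> : enorm (z k.+1 - z k.+1) = 0 by apply/eqP; rewrite enorm_eq0 subrr.
    by rewrite mulr_ge0// ltW.
  have [pX [mX [[XpX nX] mX1 cX cwX pXs]]] := suppX.
  have [pY [mY [[YpY nY] mY1 cY cwY pYs]]] := suppY.
  have [wz cwz] := zw _ zbarS.
  have kX : enorm (z k - zbar) < dX by near: k; exact: near_zbar.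
  have kY : enorm (z k - zbar) < dY by near: k; exact: near_zbar.
  have k1 : enorm (z k - zbar) < 1 by near: k; exact: near_zbar.
  (* Every distance that [smooth_push] wants small is at most [enorm (w k - zbar)], so closeness of
     [z k] alone suffices. *)
  have lt_z a d : a <= enorm (w k - zbar) -> enorm (z k - zbar) < d -> a < d.
    by move=> /le_trans /(_ wz); exact: le_lt_trans.
  set e := eps / _ in e0 pushX pushY; set rho := enorm (z k.+1 - w k) in cw cwX cwY.
  (* Both pushes use the same [s0] and the same length [e * rho], so a single point lands in both
     sets. *)
  have Sy : (X `&` Y) (z k.+1 + (e * rho) *: (s0 - z k.+1)).
    split.
      apply: (pushX pX mX) => //; rewrite ?cX//.
      - exact: lt_z (pXs _ zbarS.1) kX.
      - exact: lt_z kX.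
      - exact: lt_z (cw _ zbarS) kX.
    apply: (pushY pY mY) => //; rewrite ?cY//.
    - exact: lt_z (pYs _ zbarS.2) kY.
    - exact: lt_z kY.
    - exact: lt_z (cw _ zbarS) kY.
  apply: le_trans (dist_set_le _ _ _ Sy) _.
  rewrite opprD addrA subrr add0r -scaleNr enormZ normrN.
  have rho_dist : rho <= dist_set (z k) (X `&` Y).
    by apply: dist_set_ge => // s Ss; apply: le_trans (cw s Ss) (zw s Ss).1.
  have erho0 : 0 <= e * rho by rewrite mulr_ge0 ?enorm_ge0// ltW.
  rewrite ger0_norm//.
  have zM : enorm (s0 - z k.+1) <= enorm (s0 - zbar) + 1.
    apply: le_trans (enorm_dist_triangle zbar _ _) _; rewrite lerD2l enormB.
    by apply: ltW; exact: lt_z k1.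
  apply: le_trans (ler_wpM2l erho0 zM) _.
  by rewrite mulrAC /e divfK ?gt_eqF// ler_pM2l.
have dist_cvg (a : nat -> R) :
    (forall k, 0 <= a k <= enorm (z k - zbar)) -> a @ \oo --> 0.
  move=> az; apply/cvgrPdist_lt => e e0; near=> k.
  have /andP[a0 ak] := az k; rewrite sub0r normrN ger0_norm// (le_lt_trans ak)//.
  by near: k; exact: near_zbar.
split; split=> //.
- by apply: dist_cvg => k; rewrite dist_ge0 dist_zbar.
- by move=> k; exact: enorm_ge0.
- by apply: dist_cvg => k; rewrite enorm_ge0 lexx.
(* The half absorbs the factor 2 of [zbar_dist]; [dist_zbar] then returns from the distance to the
   iterates. *)
move=> eps eps0; have e20 : 0 < eps / 2 by rewrite divr_gt0.
apply: filterS (rate _ e20) => k rk; apply: le_trans (zbar_dist _) _.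
apply: le_trans (_ : eps * dist_set (z k) (X `&` Y) <= _); first by lra.
by rewrite ler_pM2l.
Unshelve. all: by end_near. Qed.
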